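(* Let $0<q<1$, let $\alpha>0$ be a real number, and let $u,v>0$. (i) $$N_q\left(x^{\alpha-1}\right)(u;v)=\frac{(1-q)^{\alpha-1}}{v^{\alpha}}\,u^{\alpha-1}\,\Gamma_q(\alpha).$$ (ii) Let $a\in\mathbb{R}$, let $m\ge1$ and $0\le k\le m$ be integers, and let $$f(x)={}_{m-k}\Phi_{m-1}\left[\left.\begin{array}{c}a_1,a_2,\dots,a_{m-k}\\ b_1,b_2,\dots,b_{m-1}\end{array}\right|q,ax\right],$$ where no $b_j$ is of the form $q^{-i}$ with $i\ge0$ an integer, and assume the power series defining $f$ converges at $x=u/v$ (automatic if $k\ge1$). Then $$N_q\left(x^{\alpha-1}f(x)\right)(u;v)=\frac{\Gamma_q(\alpha)(1-q)^{\alpha-1}u^{\alpha-1}}{v^{\alpha}}\;{}_{m-k+1}\Phi_{m}\left[\left.\begin{array}{c}a_1,a_2,\dots,a_{m-k},q^{\alpha}\\ b_1,b_2,\dots,b_{m-1},0\end{array}\right|q,\frac{au}{v}\right].$$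
   Context: For $0<q<1$: $(a;q)_n=\prod_{k=0}^{n-1}(1-aq^k)$, $(a;q)_\infty=\prod_{k\ge0}(1-aq^k)$, $(a_1,\dots,a_p;q)_n=\prod_{j=1}^p(a_j;q)_n$, and $E_q(t)=(t;q)_\infty$. The $q$-gamma function is $\Gamma_q(x)=\frac{(q;q)_\infty}{(q^x;q)_\infty}(1-q)^{1-x}$. The Jackson integral is $\int_0^a f(x)\,d_qx=(1-q)a\sum_{k\ge0}f(aq^k)q^k$. The $q$-Natural transform of the first type is $$N_q(f)(u;v)=\frac{1}{(1-q)u}\int_0^{u/v}f(t)\,E_q\!\left(q\tfrac{v}{u}t\right)d_qt=\frac{(q;q)_\infty}{v}\sum_{k\ge0}\frac{q^kf\left(\frac uv q^k\right)}{(q;q)_k},$$ and $N_q(g(x))(u;v)$ denotes the transform of the function $x\mapsto g(x)$. The $q$-hypergeometric function is $${}_{r}\Phi_{s}\left[\left.\begin{array}{c}a_1,\dots,a_r\\ b_1,\dots,b_s\end{array}\right|q,z\right]=\sum_{n\ge0}\frac{(a_1,\dots,a_r;q)_n}{(b_1,\dots,b_s;q)_n}\left[(-1)^nq^{\binom n2}\right]^{1+s-r}\frac{z^n}{(q;q)_n};$$ thus both ${}_{m-k}\Phi_{m-1}$ and ${}_{m-k+1}\Phi_m$ carry the exponent $k$ on the bracket. The parameter $0$ contributes $(0;q)_n=1$. *)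

(* Defs.v *)
From Stdlib Require Import Reals List ZArith.
From Coquelicot Require Import Coquelicot.
Open Scope C_scope.

(* The base q and the variables of integration are real; values and
   hypergeometric parameters are complex, real ones being embedded by RtoC.
   Limits and sums are total operators built on [iota] (as Coquelicot's RInt),
   meaningful when the limit exists. *)

Definition Clim_seq (w : nat -> C) : C :=
  iota (T := C_CompleteNormedModule) (fun l : C => filterlim w eventually (locally l)).

Definition CSeries (w : nat -> C) : C :=
  iota (T := C_CompleteNormedModule) (fun l : C => is_series (V := C_NormedModule) w l).

Fixpoint qpoch (a : C) (q : R) (n : nat) : C :=
  match n with
  | O => 1
  | S p => qpoch a q p * (1 - a * RtoC (q ^ p))
  end.

Definition qpoch_list (l : list C) (q : R) (n : nat) : C :=
  fold_right (fun a p => qpoch a q n * p) (RtoC 1) l.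

Definition qpoch_inf (a : C) (q : R) : C := Clim_seq (qpoch a q).

Definition E_q (q : R) (t : C) : C := qpoch_inf t q.

Definition Gamma_q (q x : R) : C :=
  qpoch_inf (RtoC q) q / qpoch_inf (RtoC (Rpower q x)) q
  * RtoC (Rpower (1 - q) (1 - x)).

Definition Jackson_term (q : R) (f : R -> C) (a : R) (k : nat) : C :=
  f (a * q ^ k)%R * RtoC (q ^ k).

Definition ex_Jackson (q : R) (f : R -> C) (a : R) : Prop :=
  ex_series (V := C_NormedModule) (Jackson_term q f a).

Definition Jackson (q : R) (f : R -> C) (a : R) : C :=
  RtoC ((1 - q) * a) * CSeries (Jackson_term q f a).

Definition natural_integrand (q : R) (f : R -> C) (u v : R) (t : R) : C :=
  f t * E_q q (RtoC (q * (v / u) * t)).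

Definition ex_natural (q : R) (f : R -> C) (u v : R) : Prop :=
  ex_Jackson q (natural_integrand q f u v) (u / v).

Definition natural (q : R) (f : R -> C) (u v : R) : C :=
  RtoC (/ ((1 - q) * u)) * Jackson q (natural_integrand q f u v) (u / v).

(* The power 1 + s - r is an integer power, since it is negative for r > s + 1;
   n * (n - 1) / 2 is the binomial coefficient (n choose 2). *)
Definition Phi_term (aa bb : list C) (q : R) (z : C) (n : nat) : C :=
  qpoch_list aa q n / qpoch_list bb q n
  * RtoC (powerRZ ((-1) ^ n * q ^ (n * (n - 1) / 2))
            (1 + Z.of_nat (length bb) - Z.of_nat (length aa)))
  * (z ^ n / qpoch (RtoC q) q n).

Definition ex_Phi (aa bb : list C) (q : R) (z : C) : Prop :=
  ex_series (V := C_NormedModule) (Phi_term aa bb q z).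

Definition Phi (aa bb : list C) (q : R) (z : C) : C :=
  CSeries (Phi_term aa bb q z).

(* Main.v *)
(* Let F(z) = sum_k z^k / (q;q)_k. From F(z) - F(zq) = z F(z) one gets F(z q^n) = (z;q)_n F(z),
   and n -> oo gives Euler's identity (z;q)_oo = 1 / F(z). Hence E_q(q^(k+1)) = (q;q)_oo / (q;q)_k,
   which turns the Jackson integral into a sum over k with weights 1 / (q;q)_k. For x^(alpha-1)
   that sum is a multiple of F(q^alpha). In (ii), write d_n for the n-th term of f(u/v); exchanging the sums over k and n leaves
   sum_n d_n F(q^(alpha+n)) = F(q^alpha) sum_n d_n (q^alpha;q)_n. *)

Require Import Defs.
From Stdlib Require Import Reals List ZArith Lra Lia.
From Coquelicot Require Import Coquelicot.
Open Scope C_scope.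

(** * Series in normed modules: bounds, remainders, exchange of summation *)

Lemma is_series_incr_1_zero (x : nat -> R) (l : R) :
  is_series x l -> x 0%nat = 0%R -> is_series (fun k => x (S k)) l.
Proof.
intros H E. apply is_series_incr_1. rewrite E.
now rewrite (plus_zero_r (G := R_AbelianMonoid)).
Qed.

Lemma norm_series_le {K : AbsRing} {V : NormedModule K}
    (x : nat -> V) (b : nat -> R) (l : V) (lb : R) :
  is_series x l -> is_series b lb -> (forall n, (norm (x n) <= b n)%R) ->
  (norm l <= lb)%R.
Proof.
intros Hx Hb Hle.
apply (is_lim_seq_le (fun n => norm (sum_n x n)) (sum_n b) (norm l) lb).
- intros n. induction n as [|n IH].
  + rewrite !sum_O. apply Hle.
  + rewrite !sum_Sn. eapply Rle_trans; [apply norm_triangle|].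
    apply Rplus_le_compat; [exact IH | apply Hle].
- apply (filterlim_comp _ _ _ (sum_n x) norm _ _ _ Hx), filterlim_norm.
- exact Hb.
Qed.

Lemma is_lim_series_remainder {K : AbsRing} {V : NormedModule K} (x : nat -> V) (l : V) :
  is_series x l -> is_lim_seq (fun N => norm (minus l (sum_n x N))) 0.
Proof.
intros H. apply is_lim_seq_spec. intros eps.
destruct (proj1 (filterlim_locally_ball_norm (F := eventually) _ _) H eps) as [N0 HN0].
exists N0. intros N HN. specialize (HN0 N HN). unfold ball_norm in HN0.
rewrite Rminus_0_r, Rabs_pos_eq by apply norm_ge_0.
now rewrite <- norm_opp, opp_minus.
Qed.

Lemma is_series_sum_n {K : AbsRing} {V : NormedModule K}
    (F : nat -> nat -> V) (H : nat -> V) (N : nat) :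
  (forall n, is_series (F n) (H n)) ->
  is_series (fun k => sum_n (fun n => F n k) N) (sum_n H N).
Proof.
intros HF. induction N as [|N IH].
- rewrite sum_O. apply is_series_ext with (2 := HF 0%nat).
  intros k. now rewrite sum_O.
- rewrite sum_Sn.
  apply is_series_ext with (2 := is_series_plus _ _ _ _ IH (HF (S N))).
  intros k. now rewrite sum_Sn.
Qed.

(** The remainder of row k after N is at most [e N * w k], with [e] independent of k. Summing over k
    bounds the distance from the sum T of [G] to the N-th partial sum of [H] by [e N] times the sum
    of [w], which tends to 0. *)
Lemma series_exchange {K : AbsRing} {V : CompleteNormedModule K}
    (F : nat -> nat -> V) (G H : nat -> V) (e w : nat -> R) :
  ex_series w -> is_lim_seq e 0 ->
  (forall N k, (norm (minus (G k) (sum_n (fun n => F n k) N)) <= e N * w k)%R) ->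
  (forall n, is_series (F n) (H n)) ->
  exists T : V, is_series G T /\ is_series H T.
Proof.
intros [W HW] He Hle HF.
assert (HG : ex_series G).
(* [G k] is split into its remainder after the term n = 0, dominated by [e 0 * w k], and that term
   itself, summable in k. *)
{ apply ex_series_ext with
    (fun k => plus (minus (G k) (sum_n (fun n => F n k) 0)) (F 0%nat k)).
  - intros k. rewrite sum_O. unfold minus.
    now rewrite <- plus_assoc, plus_opp_l, plus_zero_r.
  - apply (ex_series_plus (V := V)); [|now exists (H 0%nat)].
    apply (ex_series_le _ (fun k => e 0%nat * w k)%R); [apply Hle|].
    exists (scal (e 0%nat) W). now apply (is_series_scal (e 0%nat) w). }
destruct HG as [T HT]. exists T. split; [exact HT|].
assert (Hb : forall N, (norm (minus T (sum_n H N)) <= e N * W)%R).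
{ intros N. eapply norm_series_le; [| |apply (Hle N)].
  - apply (is_series_minus (V := V)); [exact HT | now apply (is_series_sum_n (V := V))].
  - now apply (is_series_scal (e N) w). }
apply filterlim_locally_ball_norm. intros eps.
assert (He' : is_lim_seq (fun N => e N * W)%R 0).
{ replace (Finite 0) with (Rbar_mult 0 W) by (simpl; f_equal; ring).
  now apply is_lim_seq_scal_r. }
apply is_lim_seq_spec in He'. destruct (He' eps) as [N0 HN0].
exists N0. intros N HN. unfold ball_norm.
rewrite <- norm_opp, opp_minus.
eapply Rle_lt_trans; [apply Hb|].
eapply Rle_lt_trans; [apply Rle_abs|].
specialize (HN0 N HN). now rewrite Rminus_0_r in HN0.
Qed.

(** * Euler's series over the reals, with a real copy of [qpoch] *)

Fixpoint rpoch (a q : R) (n : nat) : R :=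
  match n with
  | O => 1
  | S p => rpoch a q p * (1 - a * q ^ p)
  end%R.

Lemma qpoch_RtoC (a q : R) (n : nat) : qpoch (RtoC a) q n = RtoC (rpoch a q n).
Proof.
induction n as [|n IH]; [reflexivity|].
simpl. now rewrite IH, RtoC_mult, RtoC_minus, RtoC_mult.
Qed.

(** The function F of the overview, as a real power series so that radius of convergence and
    continuity results apply. *)
Definition euler_series (q z : R) : R := PSeries (fun k => / rpoch q q k)%R z.

Section Euler.

Variable q : R.
Hypothesis Hq : (0 < q < 1)%R.

Lemma q_pow_lt_1 (n : nat) : (0 < q ^ n <= 1)%R.
Proof.
split; [apply pow_lt; lra|].
rewrite <- (pow1 n). apply pow_incr. lra.
Qed.

Lemma rpoch_q_pos (n : nat) : (0 < rpoch q q n)%R.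
Proof.
induction n as [|n IH]; simpl; [lra|].
apply Rmult_lt_0_compat; [exact IH|].
destruct (q_pow_lt_1 n). nra.
Qed.

(** The ratio of consecutive coefficients is 1 / (1 - q^(n+1)), which tends to 1. *)
Lemma CV_radius_euler : CV_radius (fun k => / rpoch q q k)%R = 1.
Proof.
replace (Finite 1) with (Rbar_inv 1) by (simpl; f_equal; field).
apply (CV_radius_finite_DAlembert _ 1); [|lra|].
- intros n. apply Rinv_neq_0_compat. pose proof (rpoch_q_pos n). lra.
- apply is_lim_seq_ext with (fun n => / (1 - q * q ^ n))%R.
  + intros n. pose proof (rpoch_q_pos n). pose proof (q_pow_lt_1 n).
    assert (0 < 1 - q * q ^ n)%R by nra.
    rewrite Rabs_pos_eq; simpl.
    * field. lra.
    * apply Rlt_le, Rdiv_lt_0_compat; apply Rinv_0_lt_compat; nra.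
  + replace (Finite 1) with (Rbar_inv (Finite (1 - q * 0)))
      by (simpl; f_equal; field).
    apply is_lim_seq_inv.
    * apply is_lim_seq_minus'; [apply is_lim_seq_const|].
      apply (is_lim_seq_scal_l _ q 0), is_lim_seq_geom.
      rewrite Rabs_pos_eq; lra.
    * simpl. intros E. injection E. lra.
Qed.

Lemma ex_euler_series (z : R) : (0 <= z < 1)%R ->
  ex_pseries (fun k => / rpoch q q k)%R z.
Proof.
intros Hz. apply CV_radius_inside. rewrite CV_radius_euler. simpl.
rewrite Rabs_pos_eq; lra.
Qed.

Lemma is_euler_series (z : R) : (0 <= z < 1)%R ->
  is_series (fun k => z ^ k / rpoch q q k)%R (euler_series q z).
Proof.
intros Hz. apply is_series_ext with (fun k => / rpoch q q k * z ^ k)%R.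
{ intros k. apply Rmult_comm. }
apply is_pseries_R, PSeries_correct. now apply ex_euler_series.
Qed.

(** In F(z) - F(zq) the k-th term carries the factor 1 - q^k. It cancels the last factor of (q;q)_k
    and leaves z times the preceding term of F(z); the term k = 0 vanishes, so the index can be
    shifted. *)
Lemma euler_series_q (z : R) : (0 <= z < 1)%R ->
  euler_series q (z * q) = ((1 - z) * euler_series q z)%R.
Proof.
intros Hz.
assert (Hzq : (0 <= z * q < 1)%R) by nra.
pose proof (is_series_minus _ _ _ _ (is_euler_series z Hz)
  (is_euler_series (z * q) Hzq)) as H1.
pose proof (is_series_scal z _ _ (is_euler_series z Hz)) as H2.
assert (E : (euler_series q z - euler_series q (z * q) = z * euler_series q z)%R); [|lra].
apply is_series_incr_1_zero in H1.
2:{ change (1 / 1 - 1 / 1 = 0)%R. field. }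
refine (eq_trans (eq_sym (is_series_unique _ _ H1))
  (eq_trans _ (is_series_unique _ _ H2))).
apply Series_ext. intros k. change (z ^ S k / rpoch q q (S k) - (z * q) ^ S k / rpoch q q (S k)
  = z * (z ^ k / rpoch q q k))%R.
pose proof (rpoch_q_pos k). pose proof (rpoch_q_pos (S k)) as HS. simpl in HS |- *.
rewrite Rpow_mult_distr. field. split; nra.
Qed.

Lemma euler_series_q_pow (z : R) (n : nat) : (0 <= z < 1)%R ->
  euler_series q (z * q ^ n) = (rpoch z q n * euler_series q z)%R.
Proof.
intros Hz. induction n as [|n IH]; simpl.
- rewrite Rmult_1_r. ring.
- pose proof (q_pow_lt_1 n).
  replace (z * (q * q ^ n))%R with (z * q ^ n * q)%R by ring.
  rewrite euler_series_q, IH by nra. ring.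
Qed.

(** The arguments tend to 0, where F is continuous with value 1. *)
Lemma is_lim_euler_series_q_pow (z : R) :
  is_lim_seq (fun n => euler_series q (z * q ^ n))%R 1.
Proof.
replace (Finite 1) with (Finite (euler_series q (z * 0))).
2:{ unfold euler_series. rewrite Rmult_0_r, PSeries_0. simpl. f_equal. field. }
apply is_lim_seq_continuous.
- apply PSeries_continuity. rewrite CV_radius_euler. simpl.
  rewrite Rmult_0_r, Rabs_R0. lra.
- apply (is_lim_seq_scal_l _ z 0), is_lim_seq_geom. rewrite Rabs_pos_eq; lra.
Qed.

(** If F(z) = 0, then F(z q^n) = (z;q)_n F(z) vanishes for every n, against the limit 1. *)
Lemma euler_series_neq_0 (z : R) : (0 <= z < 1)%R -> euler_series q z <> 0%R.
Proof.
intros Hz E. pose proof (is_lim_euler_series_q_pow z) as H.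
apply is_lim_seq_ext with (v := fun _ => 0%R) in H.
- apply is_lim_seq_unique in H. rewrite Lim_seq_const in H.
  injection H. lra.
- intros n. rewrite euler_series_q_pow, E by exact Hz. ring.
Qed.

Lemma is_lim_rpoch (z : R) : (0 <= z < 1)%R ->
  is_lim_seq (rpoch z q) (/ euler_series q z)%R.
Proof.
intros Hz. pose proof (euler_series_neq_0 z Hz).
apply is_lim_seq_ext with (fun n => euler_series q (z * q ^ n) * / euler_series q z)%R.
{ intros n. rewrite euler_series_q_pow by exact Hz. now field. }
replace (Finite (/ euler_series q z)) with (Rbar_mult 1 (/ euler_series q z)%R)
  by (simpl; f_equal; ring).
apply (is_lim_seq_scal_r _ _ 1), is_lim_euler_series_q_pow.
Qed.

(** These are the moments, at the nodes q^k, of the weights z^k / (q;q)_k: since z^k (q^k)^n = (z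
    q^n)^k, the n-th one is F(z q^n). *)
Lemma is_series_euler_moment (z : R) (n : nat) : (0 <= z < 1)%R ->
  is_series (fun k => z ^ k / rpoch q q k * (q ^ k) ^ n)%R
    (rpoch z q n * euler_series q z)%R.
Proof.
intros Hz. rewrite <- euler_series_q_pow by exact Hz.
pose proof (q_pow_lt_1 n).
apply is_series_ext with (2 := is_euler_series (z * q ^ n) ltac:(nra)).
intros k. change ((z * q ^ n) ^ k / rpoch q q k = z ^ k / rpoch q q k * (q ^ k) ^ n)%R.
rewrite Rpow_mult_distr, <- !pow_mult, Nat.mul_comm. simpl. unfold Rdiv. ring.
Qed.

End Euler.

(** * Passage to complex values, and the transform as a weighted series *)

Lemma CSeries_unique (x : nat -> C) (l : C) :
  is_series (V := C_NormedModule) x l -> CSeries x = l.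
Proof.
intros H. unfold CSeries.
apply (iota_filterlim_locally (V := C_CompleteNormedModule) (sum_n x) l H).
Qed.

Lemma ex_series_CSeries (x : nat -> C) :
  ex_series (V := C_NormedModule) x -> is_series (V := C_NormedModule) x (CSeries x).
Proof. intros [l H]. now rewrite (CSeries_unique x l H). Qed.

Lemma filterlim_RtoC (x : nat -> R) (l : R) : is_lim_seq x l ->
  filterlim (fun n => RtoC (x n)) eventually (locally (T := C_UniformSpace) (RtoC l)).
Proof.
intros H. apply filterlim_locally. intros eps.
apply is_lim_seq_spec in H. destruct (H eps) as [N HN].
exists N. intros n Hn. split; [exact (HN n Hn) | apply ball_center].
Qed.

Lemma is_series_RtoC (x : nat -> R) (l : R) : is_series x l ->
  is_series (V := C_NormedModule) (fun n => RtoC (x n)) (RtoC l).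
Proof.
intros H. apply filterlim_ext with (fun n => RtoC (sum_n x n)).
- intros n. induction n as [|n IH]; [now rewrite !sum_O|].
  rewrite !sum_Sn, <- IH. apply RtoC_plus.
- now apply filterlim_RtoC.
Qed.

Lemma qpoch_inf_euler (q z : R) : (0 < q < 1)%R -> (0 <= z < 1)%R ->
  qpoch_inf (RtoC z) q = RtoC (/ euler_series q z).
Proof.
intros Hq Hz. unfold qpoch_inf, Clim_seq.
apply (iota_filterlim_locally (V := C_CompleteNormedModule)).
apply filterlim_ext with (fun n => RtoC (rpoch z q n)).
- intros n. symmetry. apply qpoch_RtoC.
- now apply filterlim_RtoC, is_lim_rpoch.
Qed.

Lemma E_q_pow (q : R) (k : nat) : (0 < q < 1)%R ->
  E_q q (RtoC (q * q ^ k)) = RtoC (/ euler_series q q / rpoch q q k).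
Proof.
intros Hq. pose proof (q_pow_lt_1 q Hq k). pose proof (rpoch_q_pos q Hq k).
pose proof (euler_series_neq_0 q Hq q ltac:(lra)).
unfold E_q. rewrite qpoch_inf_euler, euler_series_q_pow by nra.
f_equal. field. lra.
Qed.

(** At the node t = (u/v) q^k the argument q (v/u) t equals q^(k+1), so [E_q_pow] turns the kernel
    into (q;q)_oo / (q;q)_k. The prefactors 1 / ((1-q) u) and (1-q) u / v multiply to 1 / v. *)
Lemma natural_series (q u v : R) (g : R -> C) (l : C) :
  (0 < q < 1)%R -> (0 < u)%R -> (0 < v)%R ->
  is_series (V := C_NormedModule)
    (fun k => g (u / v * q ^ k)%R * RtoC (q ^ k / rpoch q q k)) l ->
  ex_natural q g u v /\
  natural q g u v = qpoch_inf (RtoC q) q / RtoC v * l.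
Proof.
intros Hq Hu Hv H.
rewrite qpoch_inf_euler by lra.
assert (H' : is_series (V := C_NormedModule)
  (Jackson_term q (natural_integrand q g u v) (u / v))
  (RtoC (/ euler_series q q) * l)).
{ apply is_series_ext with (2 := is_series_scal (V := C_NormedModule)
    (RtoC (/ euler_series q q)) _ _ H).
  intros k. unfold Jackson_term, natural_integrand.
  replace (q * (v / u) * (u / v * q ^ k))%R with (q * q ^ k)%R by (field; lra).
  rewrite E_q_pow by exact Hq. unfold Rdiv. rewrite !RtoC_mult.
  change (RtoC (/ euler_series q q) *
    (g (u * / v * q ^ k)%R * (RtoC (q ^ k) * RtoC (/ rpoch q q k))) =
    g (u * / v * q ^ k)%R * (RtoC (/ euler_series q q) * RtoC (/ rpoch q q k)) * RtoC (q ^ k)).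
  ring. }
split; [now exists (RtoC (/ euler_series q q) * l)|].
unfold natural, Jackson. rewrite (CSeries_unique _ _ H').
replace (RtoC (/ euler_series q q) / RtoC v * l)
  with (RtoC (/ v) * (RtoC (/ euler_series q q) * l)).
- rewrite Cmult_assoc, <- RtoC_mult. do 2 f_equal. field. lra.
- rewrite RtoC_inv by lra. unfold Cdiv. ring.
Qed.

(** * Exchange of the sums over k and n *)

Lemma ex_series_bounded {K : AbsRing} {V : NormedModule K} (d : nat -> V) :
  ex_series d -> exists M : R, forall n, (norm (d n) <= M)%R.
Proof.
intros H. destruct (filterlim_bounded (sum_n d) H) as [M HM].
exists (M + M)%R. intros n.
pose proof (norm_ge_0 (sum_n d n)) as H0. pose proof (HM n) as Hn.
destruct n as [|n]; [rewrite sum_O in *; lra|].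
replace (d (S n)) with (minus (sum_n d (S n)) (sum_n d n)).
- eapply Rle_trans; [apply norm_triangle|]. rewrite norm_opp.
  now apply Rplus_le_compat.
- rewrite sum_Sn. unfold minus. rewrite (plus_comm (sum_n d n)), <- plus_assoc.
  exact (eq_trans (f_equal (plus (d (S n))) (plus_opp_r (sum_n d n))) (plus_zero_r _)).
Qed.

Lemma Cnorm_mult (x y : C) :
  norm (V := C_NormedModule) (x * y)%C = (norm (V := C_NormedModule) x * norm (V := C_NormedModule) y)%R.
Proof. apply Cmod_mult. Qed.

Lemma Cnorm_RtoC_nonneg (x : R) : (0 <= x)%R -> norm (V := C_NormedModule) (RtoC x) = x.
Proof. intros H. change (Cmod (RtoC x) = x). rewrite Cmod_R. now apply Rabs_pos_eq. Qed.

(** Meant for the rows x = q^k with k >= 1. Each term is at most M q^n in norm, and the geometric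
    tail from N + 1 on gives a remainder bound independent of x. *)
Lemma Cseries_geom_dominated (d : nat -> C) (M q x : R) :
  (0 < q < 1)%R -> (0 <= x <= q)%R ->
  (forall n, (norm (V := C_NormedModule) (d n) <= M)%R) ->
  exists l : C, is_series (V := C_NormedModule) (fun n => d n * RtoC (x ^ n)) l /\
  forall N, (norm (V := C_NormedModule)
    (minus (G := C_AbelianGroup) l
      (sum_n (G := C_AbelianMonoid) (fun n => (d n * RtoC (x ^ n))%C) N))
    <= M * q ^ S N / (1 - q))%R.
Proof.
intros Hq Hx HM.
assert (Hle : forall n, (norm (V := C_NormedModule) (d n * RtoC (x ^ n))%C <= M * q ^ n)%R).
{ intros n. assert (0 <= x ^ n <= q ^ n)%R by (split; [apply pow_le | apply pow_incr]; lra).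
  rewrite Cnorm_mult, Cnorm_RtoC_nonneg by lra.
  apply Rmult_le_compat; try lra; [apply norm_ge_0 | apply HM]. }
assert (Hg : is_series (fun n => q ^ n)%R (/ (1 - q))%R)
  by (apply is_series_geom; rewrite Rabs_pos_eq; lra).
destruct (ex_series_le (V := C_CompleteNormedModule) _ (fun n => M * q ^ n)%R Hle) as [l Hl].
{ exists (M * / (1 - q))%R. exact (is_series_scal M _ _ Hg). }
exists l. split; [exact Hl|]. intros N.
eapply norm_series_le with (b := fun n => (M * q ^ (S N + n))%R).
(* The shift rule expects the full sum in the form (l - s) + s, with s the partial sum up to N, so l
   is rewritten that way. *)
- apply (is_series_incr_n (V := C_NormedModule) (fun n => d n * RtoC (x ^ n)) (S N)); [lia|].
  refine (eq_ind l (fun y => is_series (V := C_NormedModule) _ y) Hl _ _).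
  change (Init.Nat.pred (S N)) with N. simpl. set (s := sum_n _ _).
  enough (Es : forall y z : C, y = y - z + z) by apply Es. intros y z. ring.
- apply is_series_ext with (2 := is_series_scal (M * q ^ S N)%R _ _ Hg).
  intros n. change (M * q ^ S N * q ^ n = M * q ^ (S N + n))%R. rewrite pow_add. ring.
- intros n. apply Hle.
Qed.

(* The row [k = 0] is not assumed to converge absolutely, so its remainder is bounded apart from the rows
   [k >= 1], which are dominated by a geometric series. *)
Lemma is_series_moment_exchange (d : nat -> C) (q : R) (w W : nat -> R) :
  (0 < q < 1)%R -> ex_series (V := C_NormedModule) d -> (forall k, (0 <= w k)%R) ->
  (forall n, is_series (fun k => w k * (q ^ k) ^ n)%R (W n)) ->
  exists T : C,
    is_series (V := C_NormedModule)
      (fun k => CSeries (fun n => d n * RtoC ((q ^ k) ^ n)) * RtoC (w k)) T /\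
    is_series (V := C_NormedModule) (fun n => d n * RtoC (W n)) T.
Proof.
intros Hq Hd Hw HW.
destruct (ex_series_bounded d Hd) as [M HM].
assert (HM0 : (0 <= M)%R) by (eapply Rle_trans; [apply (norm_ge_0 (V := C_NormedModule)) | apply (HM 0%nat)]).
set (e0 := fun N => norm (V := C_NormedModule)
  (minus (G := C_AbelianGroup) (CSeries d) (sum_n (G := C_AbelianMonoid) d N))).
(* One error must serve every row: [e0 N] is the remainder of row 0, and the geometric tail covers
   the rows k >= 1. *)
apply (series_exchange (V := C_CompleteNormedModule)
  (fun n k => d n * RtoC (w k * (q ^ k) ^ n)) _ _
  (fun N => e0 N + M * q ^ S N / (1 - q))%R w).
(* The moment n = 0 is the sum of the weights. *)
- exists (W 0%nat). apply is_series_ext with (2 := HW 0%nat).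
  intros k. apply Rmult_1_r.
- replace (Finite 0) with (Finite (0 + 0)) by (f_equal; ring).
  apply is_lim_seq_plus'.
  + exact (is_lim_series_remainder (V := C_NormedModule) d _ (ex_series_CSeries d Hd)).
  + apply is_lim_seq_ext with (fun N => M * q / (1 - q) * q ^ N)%R.
    { intros N. simpl. field. lra. }
    replace (Finite 0) with (Rbar_mult (M * q / (1 - q))%R 0) by (simpl; f_equal; ring).
    apply is_lim_seq_scal_l, is_lim_seq_geom. rewrite Rabs_pos_eq; lra.
- intros N k.
  set (g := fun n => d n * RtoC ((q ^ k) ^ n)).
  (* The weight [w k] factors out of the remainder, leaving that of the unweighted row [g]. *)
  assert (E : minus (G := C_AbelianGroup) (CSeries g * RtoC (w k))
      (sum_n (G := C_AbelianMonoid) (fun n => d n * RtoC (w k * (q ^ k) ^ n)) N) =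
    RtoC (w k) * minus (G := C_AbelianGroup) (CSeries g) (sum_n (G := C_AbelianMonoid) g N)).
  { rewrite (sum_n_ext (G := C_AbelianMonoid) _ (fun n => mult (K := C_Ring) (RtoC (w k)) (g n))),
      (sum_n_mult_l (K := C_Ring)).
    - enough (Es : forall x y t : C, x * y - y * t = y * (x - t)) by apply Es.
      intros x y t. ring.
    - intros n. unfold g. rewrite RtoC_mult.
      change (@eq C (d n * (RtoC (w k) * RtoC ((q ^ k) ^ n)))
        (RtoC (w k) * (d n * RtoC ((q ^ k) ^ n)))). ring. }
  eapply Rle_trans; [apply Req_le; exact (f_equal (norm (V := C_NormedModule)) E)|].
  rewrite Cnorm_mult, Cnorm_RtoC_nonneg, Rmult_comm by apply Hw.
  apply Rmult_le_compat_r; [apply Hw|].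
  assert (Ht : (0 <= M * q ^ S N / (1 - q))%R).
  { pose proof (q_pow_lt_1 q Hq (S N)). apply Rmult_le_pos; [nra|].
    apply Rlt_le, Rinv_0_lt_compat. lra. }
  destruct k as [|k].
  (* At the node q^0 = 1 the row is [d] itself. *)
  + assert (Eg : forall n, d n = g n).
    { intros n. unfold g. simpl. rewrite pow1. ring. }
    assert (Es : CSeries g = CSeries d).
    { apply CSeries_unique, is_series_ext with (2 := ex_series_CSeries d Hd). exact Eg. }
    rewrite Es, <- (sum_n_ext (G := C_AbelianMonoid) _ _ N Eg). fold (e0 N). lra.
  + destruct (Cseries_geom_dominated d M q (q ^ S k)) as [l [Hl Hb]]; try assumption.
    { pose proof (q_pow_lt_1 q Hq k). simpl. nra. }
    unfold g at 1. rewrite (CSeries_unique _ _ Hl).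
    pose proof (norm_ge_0 (V := C_NormedModule)
      (minus (G := C_AbelianGroup) (CSeries d) (sum_n (G := C_AbelianMonoid) d N))).
    specialize (Hb N). fold (e0 N) in H. unfold g. lra.
- intros n. 
  apply is_series_ext with (2 := is_series_scal (V := C_NormedModule) (d n) _ _ (is_series_RtoC _ _ (HW n))).
  reflexivity.
Qed.

(** * Terms of the q-hypergeometric series *)

Lemma qpoch_list_app (l1 l2 : list C) (q : R) (n : nat) :
  qpoch_list (l1 ++ l2) q n = qpoch_list l1 q n * qpoch_list l2 q n.
Proof.
unfold qpoch_list. induction l1 as [|c l1 IH]; simpl; [ring|].
rewrite IH. ring.
Qed.

Lemma qpoch_0 (q : R) (n : nat) : qpoch (RtoC 0) q n = 1.
Proof. induction n as [|n IH]; [reflexivity|]. simpl. rewrite IH. ring. Qed.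

(** One more parameter above and below leaves the exponent 1 + s - r unchanged, and (0;q)_n = 1, so
    only (c;q)_n is gained. *)
Lemma Phi_term_append (aa bb : list C) (q c : R) (z : C) (n : nat) :
  Phi_term (aa ++ RtoC c :: nil) (bb ++ RtoC 0 :: nil) q z n =
  Phi_term aa bb q z n * RtoC (rpoch c q n).
Proof.
unfold Phi_term. rewrite !qpoch_list_app, !length_app, <- qpoch_RtoC.
simpl length.
replace (1 + Z.of_nat (length bb + 1) - Z.of_nat (length aa + 1))%Z
  with (1 + Z.of_nat (length bb) - Z.of_nat (length aa))%Z by lia.
simpl qpoch_list. rewrite qpoch_0.
unfold Cdiv. rewrite !Cmult_1_r. ring.
Qed.

Lemma Phi_term_scale (aa bb : list C) (q : R) (z c : C) (n : nat) :
  Phi_term aa bb q (z * c) n = Phi_term aa bb q z n * c ^ n.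
Proof. unfold Phi_term. rewrite Cpow_mult_l. unfold Cdiv. ring. Qed.

(** Both values are [iota] of equivalent predicates, so the equality also covers divergent
    series. *)
Lemma CSeries_ext (x y : nat -> C) :
  (forall n, x n = y n) -> CSeries x = CSeries y.
Proof.
intros E. apply (eq_close (V := C_NormedModule)), (close_iota (T := C_CompleteNormedModule)).
intros l. split; apply is_series_ext; [|intros n; symmetry]; apply E.
Qed.

(** * Real powers at the nodes and the constant factor *)

Lemma Rpower_lt_1 (q alpha : R) :
  (0 < q < 1)%R -> (0 < alpha)%R -> (0 < Rpower q alpha < 1)%R.
Proof.
intros Hq Ha. split; [apply exp_pos|].
apply Rlt_le_trans with (Rpower 1 alpha); [now apply Rlt_Rpower_l|].
unfold Rpower. rewrite ln_1, Rmult_0_r, exp_0. lra.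
Qed.

(** The Jackson weight q^k raises q^(k(alpha-1)) to q^(k alpha); this is how q^alpha becomes the
    argument of F. *)
Lemma Rpower_node (q alpha x : R) (k : nat) : (0 < q)%R -> (0 < x)%R ->
  (Rpower (x * q ^ k) (alpha - 1) * q ^ k = Rpower x (alpha - 1) * Rpower q alpha ^ k)%R.
Proof.
intros Hq Hx. rewrite <- Rpower_mult_distr by (try apply pow_lt; assumption).
rewrite <- !Rpower_pow by (try apply exp_pos; assumption).
rewrite !Rpower_mult, Rmult_assoc, <- Rpower_plus. do 2 f_equal. ring.
Qed.

(** By Euler's identity Gamma_q(alpha) = (q;q)_oo F(q^alpha) (1-q)^(1-alpha). The powers of 1 - q
    cancel, and (u/v)^(alpha-1) v^alpha = u^(alpha-1) v. *)
Lemma natural_constant (q alpha u v : R) :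
  (0 < q < 1)%R -> (0 < alpha)%R -> (0 < u)%R -> (0 < v)%R ->
  qpoch_inf (RtoC q) q / RtoC v
    * RtoC (Rpower (u / v) (alpha - 1) * euler_series q (Rpower q alpha)) =
  Gamma_q q alpha
    * RtoC (Rpower (1 - q) (alpha - 1) * Rpower u (alpha - 1) / Rpower v alpha).
Proof.
intros Hq Ha Hu Hv. pose proof (Rpower_lt_1 q alpha Hq Ha) as Hz.
pose proof (euler_series_neq_0 q Hq q ltac:(lra)) as Hq0.
pose proof (euler_series_neq_0 q Hq (Rpower q alpha) ltac:(lra)) as Hz0.
unfold Gamma_q. rewrite !qpoch_inf_euler by lra.
rewrite <- !RtoC_div, <- !RtoC_mult by (try apply Rinv_neq_0_compat; lra).
f_equal.
assert (E1 : (Rpower (1 - q) (1 - alpha) * Rpower (1 - q) (alpha - 1) = 1)%R).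
{ rewrite <- Rpower_plus. replace (1 - alpha + (alpha - 1))%R with 0%R by ring.
  apply Rpower_O. lra. }
assert (E2 : (Rpower (u / v) (alpha - 1) * Rpower v alpha = Rpower u (alpha - 1) * v)%R).
{ replace (Rpower v alpha) with (Rpower v (alpha - 1) * v)%R.
  - rewrite <- Rmult_assoc, Rpower_mult_distr by (try apply Rdiv_lt_0_compat; assumption).
    do 2 f_equal. field. lra.
  - rewrite <- (Rpower_1 v) at 2 by exact Hv. rewrite <- Rpower_plus. f_equal. ring. }
assert (Hp : (0 < Rpower v alpha)%R) by apply exp_pos.
apply (Rmult_eq_reg_r (Rpower v alpha)); [|lra].
set (A := Rpower (1 - q) (1 - alpha)) in *. set (B := Rpower (1 - q) (alpha - 1)) in *.
transitivity (/ euler_series q q / v * euler_series q (Rpower q alpha)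
  * (Rpower (u / v) (alpha - 1) * Rpower v alpha))%R; [ring|].
rewrite E2.
transitivity (/ euler_series q q * euler_series q (Rpower q alpha) * Rpower u (alpha - 1) * (A * B))%R.
- rewrite E1. field. lra.
- field. lra.
Qed.

(** * The transforms of the power and of its product with Phi *)

Theorem theorem2 :
  forall (q alpha u v : R),
    (0 < q < 1)%R -> (0 < alpha)%R -> (0 < u)%R -> (0 < v)%R ->
    (let g := fun x : R => RtoC (Rpower x (alpha - 1)) in
     ex_natural q g u v /\
     natural q g u v =
       RtoC (Rpower (1 - q) (alpha - 1) / Rpower v alpha)
       * RtoC (Rpower u (alpha - 1)) * Gamma_q q alpha)
    /\
    (forall (a : R) (m k : nat) (aa bb : list C),
       (1 <= m)%nat -> (k <= m)%nat ->
       length aa = (m - k)%nat -> length bb = (m - 1)%nat ->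
       (forall b : C, In b bb -> forall i : nat, b <> RtoC (/ q ^ i)) ->
       ex_Phi aa bb q (RtoC (a * (u / v))) ->
       let f := fun x : R => Phi aa bb q (RtoC (a * x)) in
       let g := fun x : R => RtoC (Rpower x (alpha - 1)) * f x in
       let aa' := aa ++ RtoC (Rpower q alpha) :: nil in
       let bb' := bb ++ RtoC 0 :: nil in
       ex_natural q g u v /\
       ex_Phi aa' bb' q (RtoC (a * u / v)) /\
       natural q g u v =
         Gamma_q q alpha
         * RtoC (Rpower (1 - q) (alpha - 1) * Rpower u (alpha - 1)
                 / Rpower v alpha)
         * Phi aa' bb' q (RtoC (a * u / v))).
Proof.
intros q alpha u v Hq Ha Hu Hv.
assert (Hz : (0 < Rpower q alpha < 1)%R) by now apply Rpower_lt_1.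
assert (Huv : (0 < u / v)%R) by now apply Rdiv_lt_0_compat.
set (z := Rpower q alpha) in *. set (p := Rpower (u / v) (alpha - 1)).
split.
- intros g.
  destruct (natural_series q u v g (RtoC (p * euler_series q z)) Hq Hu Hv) as [H1 H2].
  + apply is_series_ext with (fun k => RtoC (p * (z ^ k / rpoch q q k))).
    * intros k. unfold g. rewrite <- RtoC_mult. f_equal.
      pose proof (Rpower_node q alpha (u / v) k ltac:(lra) Huv) as E. fold p z in E.
      transitivity (p * z ^ k * / rpoch q q k)%R; [unfold Rdiv; ring|].
      rewrite <- E. unfold Rdiv. ring.
    * apply is_series_RtoC.
      exact (is_series_scal p _ _ (is_euler_series q Hq z ltac:(lra))).
  + split; [exact H1|]. rewrite H2. unfold p, z. rewrite natural_constant by assumption.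
    unfold Rdiv. rewrite !RtoC_mult. ring.
- intros a m k aa bb _ _ _ _ _ HPhi f g aa' bb'.
  set (d := Phi_term aa bb q (RtoC (a * (u / v)))).
  (* The weights z^k / (q;q)_k have moments (z;q)_n F(z), so T is F(z) times the sum of the d_n
     (z;q)_n. *)
  destruct (is_series_moment_exchange d q (fun k => z ^ k / rpoch q q k)%R
    (fun n => rpoch z q n * euler_series q z)%R Hq HPhi) as [T [HT1 HT2]].
  { intros j. apply Rlt_le, Rdiv_lt_0_compat; [apply pow_lt; lra | now apply rpoch_q_pos]. }
  { intros n. apply is_series_euler_moment; lra. }
  (* Dividing by F(z), which is nonzero, leaves exactly the terms with q^alpha and 0 appended. *)
  assert (HP : is_series (V := C_NormedModule) (Phi_term aa' bb' q (RtoC (a * u / v)))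
    (RtoC (/ euler_series q z) * T)).
  { apply is_series_ext with (2 := is_series_scal (V := C_NormedModule)
      (RtoC (/ euler_series q z)) _ _ HT2).
    intros n. unfold aa', bb'. rewrite Phi_term_append.
    replace (a * u / v)%R with (a * (u / v))%R by (field; lra). fold z. fold d.
    rewrite RtoC_mult.
    change (RtoC (/ euler_series q z) * (d n * (RtoC (rpoch z q n) * RtoC (euler_series q z)))
      = d n * RtoC (rpoch z q n)).
    rewrite RtoC_inv by (apply euler_series_neq_0; lra).
    field. intros E. apply RtoC_inj in E. revert E. apply euler_series_neq_0; lra. }
  destruct (natural_series q u v g (RtoC p * T) Hq Hu Hv) as [H1 H2].
  + apply is_series_ext with (2 := is_series_scal (V := C_NormedModule) (RtoC p) _ _ HT1).
    intros j. unfold g, f, Phi.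
    (* Moving from u/v to the node (u/v) q^j multiplies the n-th term of f by (q^j)^n. *)
    assert (Ef : CSeries (fun n => d n * RtoC ((q ^ j) ^ n)) =
      CSeries (Phi_term aa bb q (RtoC (a * (u / v * q ^ j))))).
    { apply CSeries_ext. intros n.
      replace (RtoC (a * (u / v * q ^ j))) with (RtoC (a * (u / v)) * RtoC (q ^ j))
        by (rewrite <- RtoC_mult; f_equal; ring).
      now rewrite Phi_term_scale, <- RtoC_pow. }
    rewrite Ef. set (s := CSeries _).
    pose proof (Rpower_node q alpha (u / v) j ltac:(lra) Huv) as E. fold p z in E.
    change (@eq C (RtoC p * (s * RtoC (z ^ j * / rpoch q q j)))
      (RtoC (Rpower (u / v * q ^ j) (alpha - 1)) * s * RtoC (q ^ j * / rpoch q q j))).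
    rewrite !RtoC_mult.
    transitivity (RtoC (p * z ^ j) * s * RtoC (/ rpoch q q j)); [rewrite RtoC_mult; ring|].
    rewrite <- E, RtoC_mult. ring.
  + split; [exact H1|]. split; [now exists (RtoC (/ euler_series q z) * T)|].
    (* The new Phi is T / F(z), and the factor F(z) is absorbed by [natural_constant]. *)
    rewrite H2. unfold Phi. rewrite (CSeries_unique _ _ HP).
    rewrite <- natural_constant by assumption. fold z p.
    rewrite RtoC_mult, RtoC_inv by (apply euler_series_neq_0; lra).
    field. split; intros E; apply RtoC_inj in E; revert E;
      [apply euler_series_neq_0 |]; lra.
Qed.
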